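(* Bounded ideals form a saturated class of weights on the category $\mathsf{qMet}$ of quasi-metric spaces and non-expansive maps. That is, the assignment sending each quasi-metric space $(X,d)$ to the space $(\mathcal{J}X,\rho_X)$ of bounded ideals of $(X,d)$ and each non-expansive map $f$ to $\phi\mapsto f^{\rightarrow}(\phi)$ is a saturated class of weights.
   Context: A quasi-metric space is a set $X$ with a map $d\colon X\times X\to[0,\infty]$ such that $d(x,x)=0$, $d(x,y)+d(y,z)\ge d(x,z)$, and $d(x,y)=d(y,x)=0$ implies $x=y$. A map $f\colon(X,d_X)\to(Y,d_Y)$ is non-expansive if $d_X(x,y)\ge d_Y(f(x),f(y))$ for all $x,y$. Here $a\ominus b=\max\{0,a-b\}$ for $a,b\in[0,\infty]$, with $a\ominus\infty=0$ for all $a$ (including $a=\infty$) and $\infty\ominus b=\infty$ for $b<\infty$. A weight of $(X,d)$ is a map $\phi\colon X\to[0,\infty]$ with $\phi(y)+d(x,y)\ge\phi(x)$ for all $x,y\in X$. $\mathcal{P}X$ is the set of weights with the quasi-metric $\rho_X(\phi,\psi)=\sup_{x\in X}\psi(x)\ominus\phi(x)$. For non-expansive $f\colon X\to Y$, $f^{\rightarrow}\colon\mathcal{P}X\to\mathcal{P}Y$ is $f^{\rightarrow}(\phi)(y)=\inf_{x\in X}(\phi(x)+d_Y(y,f(x)))$; this makes $\mathcal{P}$ a functor $\mathsf{qMet}\to\mathsf{qMet}$. A weight $\phi$ is an ideal if $\inf_{x}\phi(x)=0$ and $\rho_X(\phi,\lambda\wedge\mu)=\min\{\rho_X(\phi,\lambda),\rho_X(\phi,\mu)\}$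 for all $\lambda,\mu\in\mathcal{P}X$ (with $\lambda\wedge\mu$ the pointwise minimum). A weight $\phi$ is bounded if $\inf_{x\in X}\rho_X(\phi,d(-,x))<\infty$. A bounded ideal is a weight that is both bounded and an ideal; $\mathcal{J}X$ denotes the set of bounded ideals, equipped with $\rho_X$. For a non-expansive map $f\colon(K,d_K)\to(X,d_X)$ and a weight $\phi$ of $K$, the colimit $\operatorname{colim}_\phi f$ is an element $b\in X$ with $d_X(b,x)=\rho_K(\phi,d_X(f(-),x))$ for all $x\in X$. A class of weights on $\mathsf{qMet}$ is a functor $\mathcal{T}\colon\mathsf{qMet}\to\mathsf{qMet}$ such that for each $(X,d)$, $\mathcal{T}X$ is a subset of $\mathcal{P}X$ equipped with $\rho_X$; for each non-expansive $f\colon X\to Y$ and $\phi\in\mathcal{T}X$, $f^{\rightarrow}(\phi)\in\mathcal{T}Y$ and $\mathcal{T}f(\phi)=f^{\rightarrow}(\phi)$; and $d(-,x)\in\mathcal{T}X$ for every $x\in X$. It is saturated if for each $(X,d)$ and each $\Phi\in\mathcal{T}\mathcal{T}X$ (a weight of the space $(\mathcal{T}X,\rho_X)$), the colimit of the inclusion map $\mathcal{T}X\to\mathcal{P}X$ weighted by $\Phi$, which is the weight $\inf_{\phi\in\mathcal{T}X}(\Phi(\phi)+\phi)$ of $(X,d)$, belongs to $\mathcal{T}X$. *)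

(* Defs.v *)
From HB Require Import structures.
From mathcomp Require Import all_boot all_order all_algebra.
From mathcomp Require Import all_classical all_reals ereal.

Set Implicit Arguments.
Unset Strict Implicit.
Unset Printing Implicit Defensive.

Import Order.TTheory GRing.Theory Num.Theory.

Local Open Scope classical_set_scope.
Local Open Scope ring_scope.
Local Open Scope ereal_scope.

(* Elements of [0, oo] are represented by extended reals together with a proof
   of nonnegativity.  In \bar R we have +oo - +oo = -oo, so that truncating the
   difference at 0 gives a (-) +oo = 0 for all a, and +oo (-) b = +oo for
   finite b. *)
Definition ominus (R : realType) (a b : \bar R) : \bar R := maxe 0 (a - b).

(* The supremum is taken in [0, oo]: adding 0 to the family is harmless unless
   the family is empty, in which case the result is 0 rather than -oo.  An
   infimum over the empty family is +oo in \bar R as well as in [0, oo]. *)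
Definition sup0 (R : realType) (I : Type) (F : I -> \bar R) : \bar R :=
  ereal_sup (0 |` range F).

#[local] Obligation Tactic := idtac.

Record qmet (R : realType) := QMet {
  qcarrier :> Type;
  qd : qcarrier -> qcarrier -> \bar R;
  qd_ge0 : forall x y, 0 <= qd x y;
  qdxx : forall x, qd x x = 0;
  qd_triangle : forall x y z, qd x z <= qd x y + qd y z;
  qd_sep : forall x y, qd x y = 0 -> qd y x = 0 -> x = y }.

Record nonexp (R : realType) (X Y : qmet R) := NonExp {
  nonexp_fun :> X -> Y;
  nonexpP : forall x y, qd (nonexp_fun x) (nonexp_fun y) <= qd x y }.

Program Definition nonexp_id (R : realType) (X : qmet R) : nonexp X X :=
  @NonExp R X X (fun x => x) _.
Next Obligation. by []. Qed.

Program Definition nonexp_comp (R : realType) (X Y Z : qmet R)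
    (g : nonexp Y Z) (f : nonexp X Y) : nonexp X Z :=
  @NonExp R X Z (fun x => g (f x)) _.
Next Obligation.
by move=> R X Y Z g f x y; exact: le_trans (nonexpP _ _ _) (nonexpP _ _ _).
Qed.

Record weight (R : realType) (X : qmet R) := Weight {
  weight_fun :> X -> \bar R;
  weight_ge0 : forall x, 0 <= weight_fun x;
  weightP : forall x y, weight_fun x <= weight_fun y + qd x y }.

Definition rho (R : realType) (X : Type) (phi psi : X -> \bar R) : \bar R :=
  sup0 (fun x => ominus (psi x) (phi x)).

Lemma ominus_le (R : realType) (a b c : \bar R) : 0 <= b -> 0 <= c ->
  (ominus a b <= c) = (a <= b + c).
Proof.
move=> b0 c0; rewrite /ominus ge_max c0 /=.
case: b b0 => [b| |] // _; first by rewrite leeBlDl.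
rewrite addye ?leey; last by rewrite gt_eqF // (lt_le_trans _ c0).
by rewrite addeNy leNye.
Qed.

Lemma rho_ge0 (R : realType) (X : Type) (phi psi : X -> \bar R) :
  0 <= rho phi psi.
Proof. by apply: ereal_sup_ubound; left. Qed.

Lemma rho_le (R : realType) (X : Type) (phi psi : X -> \bar R) (c : \bar R) :
  (forall x, 0 <= phi x) -> 0 <= c ->
  rho phi psi <= c <-> forall x, psi x <= phi x + c.
Proof.
move=> phi0 c0; split=> [le_c x|le_c].
  rewrite -ominus_le //; apply: le_trans le_c.
  by apply: ereal_sup_ubound; right; exists x.
by apply: ge_ereal_sup => _ [->//|[x _ <-]]; rewrite ominus_le.
Qed.

Lemma weight_inj (R : realType) (X : qmet R) (phi psi : weight X) :
  (forall x, phi x = psi x) -> phi = psi.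
Proof.
case: phi psi => [f f0 fP] [g g0 gP] /= /funext fg; subst g.
by congr Weight; exact: Prop_irrelevance.
Qed.

Lemma rhoxx (R : realType) (X : qmet R) (phi : weight X) : rho phi phi = 0.
Proof.
apply/eqP; rewrite eq_le rho_ge0 andbT.
by apply/rho_le => [x||x]; rewrite ?adde0 ?weight_ge0.
Qed.

Lemma rho_triangle (R : realType) (X : qmet R) (phi psi chi : weight X) :
  rho phi chi <= rho phi psi + rho psi chi.
Proof.
apply/rho_le => [x||x]; first exact: weight_ge0.
  by rewrite adde_ge0 ?rho_ge0.
have h (a b : weight X) : b x <= a x + rho a b.
  by move: x; apply/rho_le => //; [exact: weight_ge0|exact: rho_ge0].
rewrite addeA; apply: le_trans (h psi chi) _.
by apply: leeD => //; exact: h.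
Qed.

Lemma rho_sep (R : realType) (X : qmet R) (phi psi : weight X) :
  rho phi psi = 0 -> rho psi phi = 0 -> phi = psi.
Proof.
move=> h1 h2; apply: weight_inj => x; apply/eqP; rewrite eq_le.
have h (a b : weight X) : rho a b = 0 -> b x <= a x.
  move=> ab; rewrite -[leRHS]adde0; move: x.
  by apply/rho_le => //; [exact: weight_ge0|rewrite ab].
by rewrite !h.
Qed.

(* The space of all weights of X. *)
Definition PX (R : realType) (X : qmet R) : qmet R :=
  @QMet R (weight X) (fun phi psi => rho phi psi)
    (fun phi psi => rho_ge0 phi psi) (@rhoxx R X) (@rho_triangle R X)
    (@rho_sep R X).

Definition subspace (R : realType) (X : qmet R) (S : set X) : qmet R :=
  @QMet R {x : X | S x} (fun u v => qd (sval u) (sval v))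
    (fun u v => qd_ge0 (sval u) (sval v)) (fun u => qdxx (sval u))
    (fun u v w => qd_triangle (sval u) (sval v) (sval w))
    (fun u v uv vu => eq_sig_hprop (fun x => @Prop_irrelevance (S x)) u v
       (qd_sep uv vu)).

Definition inclusion (R : realType) (X : qmet R) (S : set X) :
    nonexp (subspace S) X :=
  @NonExp R (subspace S) X (fun u => sval u) (fun u v => lexx _).

Program Definition representable (R : realType) (X : qmet R) (x : X) :
    weight X :=
  @Weight R X (fun y => qd y x) _ _.
Next Obligation. by move=> *; exact: qd_ge0. Qed.
Next Obligation. by move=> *; rewrite addeC; exact: qd_triangle. Qed.

Program Definition meet_weight (R : realType) (X : qmet R)
    (lam mu : weight X) : weight X :=
  @Weight R X (fun x => mine (lam x) (mu x)) _ _.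
Next Obligation. by move=> *; rewrite le_min !weight_ge0. Qed.
Next Obligation.
move=> R X lam mu x y /=.
by case: (leP (lam y)) => _; rewrite ge_min weightP ?orbT.
Qed.

(* inf_i (c i + phi i), where phi is a family of weights *)
Program Definition inf_weight (R : realType) (X : qmet R) (I : Type)
    (c : I -> \bar R) (c0 : forall i, 0 <= c i) (phi : I -> weight X) :
    weight X :=
  @Weight R X (fun x => ereal_inf (range (fun i => c i + phi i x))) _ _.
Next Obligation.
move=> R X I c c0 phi x /=; apply: le_ereal_inf_tmp => _ [i _ <-].
by rewrite adde_ge0 ?weight_ge0.
Qed.
Next Obligation.
move=> R X I c c0 phi x y /=.
have [->|d_fin] := eqVneq (qd x y) +oo.
  rewrite addey ?leey // gt_eqF // (@lt_le_trans _ _ 0) //.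
  by apply: le_ereal_inf_tmp => _ [i _ <-]; rewrite adde_ge0 ?weight_ge0.
have fin : qd x y \is a fin_num.
  by rewrite ge0_fin_numE ?qd_ge0 // ltey.
rewrite -leeBlDr //; apply: le_ereal_inf_tmp => _ [i _ <-].
rewrite leeBlDr // -addeA; apply: (@le_trans _ _ (c i + phi i x)).
  by apply: ereal_inf_lbound; exists i.
by rewrite leeD2l ?weightP.
Qed.

(* f^->(phi)(y) = inf_x (phi(x) + d_Y(y, f(x))) *)
Definition pushforward (R : realType) (X Y : qmet R) (f : nonexp X Y)
    (phi : weight X) : weight Y :=
  inf_weight (weight_ge0 phi) (fun x => representable (f x)).

Definition is_ideal (R : realType) (X : qmet R) (phi : weight X) : Prop :=
  ereal_inf (range phi) = 0 /\
  forall lam mu : weight X,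
    rho phi (meet_weight lam mu) = mine (rho phi lam) (rho phi mu).

Definition is_bounded (R : realType) (X : qmet R) (phi : weight X) : Prop :=
  ereal_inf (range (fun x : X => rho phi (representable x))) < +oo.

Definition bounded_ideals (R : realType) (X : qmet R) : set (PX X) :=
  [set phi : weight X | is_bounded phi /\ is_ideal phi].

Definition is_colimit (R : realType) (K X : qmet R) (phi : weight K)
    (f : nonexp K X) (b : X) : Prop :=
  forall x : X, qd b x = rho phi (fun k => qd (f k) x).

(* The action on morphisms of a functor qMet -> qMet with action obj on
   objects. *)
Record functor_on (R : realType) (obj : qmet R -> qmet R) := FunctorOn {
  fmap : forall X Y : qmet R, nonexp X Y -> nonexp (obj X) (obj Y);
  fmap_id : forall X : qmet R, fmap (nonexp_id X) = nonexp_id (obj X);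
  fmap_comp : forall (X Y Z : qmet R) (g : nonexp Y Z) (f : nonexp X Y),
    fmap (nonexp_comp g f) = nonexp_comp (fmap g) (fmap f) }.

(* The first conjunct contains the closure condition f^->(phi) \in T Y, since
   T f phi is a point of the subspace T Y. *)
Definition class_of_weights (R : realType)
    (T : forall X : qmet R, set (PX X)) : Prop :=
  (exists F : functor_on (fun X => subspace (T X)),
     forall (X Y : qmet R) (f : nonexp X Y) (phi : subspace (T X)),
       sval (fmap F f phi) = pushforward f (sval phi)) /\
  (forall (X : qmet R) (x : X), T X (representable x)).

(* The weight inf_(phi in S) (Phi(phi) + phi) of X *)
Definition inf_of (R : realType) (X : qmet R) (S : set (PX X))
    (Phi : weight (subspace S)) : weight X :=
  inf_weight (weight_ge0 Phi) (fun phi : subspace S => sval phi).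

Definition saturated (R : realType)
    (T : forall X : qmet R, set (PX X)) : Prop :=
  forall (X : qmet R) (Phi : weight (subspace (T X))),
    T (subspace (T X)) Phi ->
    is_colimit Phi (inclusion (T X)) (inf_of Phi) /\ T X (inf_of Phi).

(* Main.v *)
Require Import Defs.
From mathcomp Require Import all_boot all_order all_algebra.
From mathcomp Require Import all_classical all_reals ereal.

(** Everything rests on one formula.  For a weight [c] of [K] and a
    non-expansive [F : K -> PX X], the weight [inf_k (c k + F k)] of [X]
    is the colimit of [F] weighted by [c]:

      [rho (inf_k (c k + F k)) psi = rho c (fun k => rho (F k) psi)]

    ([rho_inf_weight]), because both sides have the same upper bounds [e],
    namely those with [psi x <= c k + F k x + e] for all [k] and [x].

    The weight [inf_of Phi] is the case where [F] is an inclusion, and, thanks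
    to the Yoneda lemma [rho (d(-, x)) psi = psi x], the pushforward along [f]
    is the case [F k = d(-, f k)].  Thus closure under pushforward and
    saturation both follow from a single fact: a colimit of bounded ideals
    weighted by a bounded ideal is a bounded ideal
    ([inf_weight_bounded_ideal]).  For binary meets, the formula gives

      [rho (inf_k (c k + F k)) (lam /\ mu)
         = rho c (fun k => min (rho (F k) lam) (rho (F k) mu))],

    and [k |-> rho (F k) lam] is again a weight of [K], so that [c] being an
    ideal takes the minimum out.  Boundedness follows from the triangle
    inequality.

    Functoriality comes from the formula as well: it reads
    [rho (f^-> phi) psi = rho phi (psi \o f)], and a weight is determined by
    its distances to all weights. *)

Set Implicit Arguments.
Unset Strict Implicit.
Unset Printing Implicit Defensive.

Import Order.TTheory GRing.Theory Num.Theory.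

Local Open Scope classical_set_scope.
Local Open Scope ring_scope.
Local Open Scope ereal_scope.

(** * Distances between weights *)

Lemma eq_ge0_ub (R : realType) (a b : \bar R) : 0 <= a -> 0 <= b ->
  (forall e, 0 <= e -> a <= e <-> b <= e) -> a = b.
Proof.
move=> a0 b0 ab; apply/eqP; rewrite eq_le; apply/andP; split.
  exact/(ab b b0).
exact/(ab a a0).
Qed.

(** Residuation by [ominus] lets the infimum be reached even when [e] is
    infinite, where [e] cannot be subtracted from both sides. *)
Lemma le_add_ereal_inf (R : realType) (I : Type) (g : I -> \bar R)
    (a e : \bar R) : (forall i, 0 <= g i) -> 0 <= e ->
  a <= ereal_inf (range g) + e <-> forall i, a <= g i + e.
Proof.
move=> g0 e0.
have inf0 : 0 <= ereal_inf (range g).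
  by apply: le_ereal_inf_tmp => _ [i _ <-].
rewrite addeC -ominus_le //; split=> [h i|h].
  rewrite addeC -ominus_le //; apply: le_trans h _.
  by apply: ereal_inf_lbound; exists i.
by apply: le_ereal_inf_tmp => _ [i _ <-]; rewrite ominus_le // addeC.
Qed.

Lemma le_add_rho (R : realType) (X : qmet R) (phi : weight X)
    (psi : X -> \bar R) x : psi x <= phi x + rho phi psi.
Proof.
move: x; apply/rho_le => //; [exact: weight_ge0|exact: rho_ge0].
Qed.

Lemma eq_rho (R : realType) (X : Type) (phi psi psi' : X -> \bar R) :
  psi =1 psi' -> rho phi psi = rho phi psi'.
Proof. by move=> /funext ->. Qed.

(** The Yoneda lemma: the weight inequality of [psi] at [x] gives one direction,
    evaluation at [x] itself the other. *)
Lemma rho_representable (R : realType) (X : qmet R) (x : X) (psi : weight X) :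
  rho (representable x) psi = psi x.
Proof.
apply/eqP; rewrite eq_le; apply/andP; split.
  apply/rho_le => [y||y]; [exact: weight_ge0|exact: weight_ge0|].
  by rewrite addeC; exact: weightP.
by have := le_add_rho (representable x) psi x; rewrite /= qdxx add0e.
Qed.

Lemma weight_eq_rho (R : realType) (X : qmet R) (phi psi : weight X) :
  (forall chi : weight X, rho phi chi = rho psi chi) -> phi = psi.
Proof. by move=> h; apply: rho_sep; rewrite (h, =^~ h) rhoxx. Qed.

(** The universal property of the weighted colimit. *)
Lemma rho_inf_weight (R : realType) (K X : qmet R) (c : weight K)
    (F : K -> weight X) (psi : weight X) :
  rho (inf_weight (weight_ge0 c) F) psi = rho c (fun k => rho (F k) psi).
Proof.
have cF0 x k : 0 <= c k + F k x by rewrite adde_ge0 ?weight_ge0.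
apply: eq_ge0_ub => [||e e0]; rewrite ?rho_ge0 //; split.
- move/(rho_le _ (weight_ge0 _) e0) => h; apply/rho_le => //.
    exact: weight_ge0.
  move=> k; apply/rho_le; first exact: weight_ge0.
    by rewrite adde_ge0 ?weight_ge0.
  move=> x; rewrite addeCA addeA.
  by move: k; apply/(le_add_ereal_inf _ (cF0 x) e0); exact: h.
- move/(rho_le _ (weight_ge0 _) e0) => h; apply/rho_le => //.
    exact: weight_ge0.
  move=> x; apply/(le_add_ereal_inf _ (cF0 x) e0) => k.
  rewrite -addeA addeCA; move: x; apply/rho_le; first exact: weight_ge0.
    by rewrite adde_ge0 ?weight_ge0.
  exact: h.
Qed.

(** * Weighted colimits of bounded ideals *)

Section Colimit.
Variables (R : realType) (K X : qmet R) (F : nonexp K (PX X)).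

(** [rho (F -) psi] as a weight of [K], to which the ideal property of a
    weight of [K] can be applied. *)
Program Definition rho_to (psi : weight X) : weight K :=
  @Weight R K (fun k => rho (F k : weight X) psi) _ _.
Next Obligation. by move=> psi k; exact: rho_ge0. Qed.
Next Obligation.
move=> psi k l /=; rewrite addeC.
apply: le_trans (rho_triangle (F k) (F l) psi) _.
by apply: leeD => //; exact: (nonexpP F).
Qed.

(** The infimum of the colimit vanishes because
    [inf_x inf_k (c k + F k x) = inf_k (c k + inf_x F k x) = inf_k c k]; it
    preserves binary meets because [c] and every [F k] do. *)
Lemma inf_weight_ideal (c : weight K) :
  is_ideal c -> (forall k, is_ideal (F k : weight X)) ->
  is_ideal (inf_weight (weight_ge0 c) F).
Proof.
move=> [c0 cI] FI; split.
  apply/eqP; rewrite eq_le; apply/andP; split; last first.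
    by apply: le_ereal_inf_tmp => _ [x _ <-]; exact: weight_ge0.
  rewrite -c0; apply: le_ereal_inf_tmp => _ [k _ <-].
  have [F0 _] := FI k.
  rewrite -[leRHS]add0e -F0; apply/le_add_ereal_inf.
  - exact: weight_ge0.
  - exact: weight_ge0.
  move=> x; rewrite addeC.
  apply: (@le_trans _ _ (inf_weight (weight_ge0 c) F x)).
    by apply: ereal_inf_lbound; exists x.
  by apply: ereal_inf_lbound; exists k.
move=> lam mu; rewrite !rho_inf_weight -(cI (rho_to lam) (rho_to mu)).
by apply: eq_rho => k; rewrite (proj2 (FI k)).
Qed.

(** If [r] bounds the distance from [c] to [d(-, k)] and [s] that from [F k] to
    [d(-, x)], then [r + s] bounds the distance from the colimit to
    [d(-, x)]. *)
Lemma inf_weight_bounded (c : weight K) :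
  is_bounded c -> (forall k, is_bounded (F k : weight X)) ->
  is_bounded (inf_weight (weight_ge0 c) F).
Proof.
move=> /ereal_inf_lt[_ [k _ <-] r_fin] /(_ k)/ereal_inf_lt[_ [x _ <-] s_fin].
set r := rho c _ in r_fin; set s := rho (F k : weight X) _ in s_fin.
apply: (@le_lt_trans _ _ (r + s)); last exact: lte_add_pinfty.
apply: (@le_trans _ _ (rho (inf_weight (weight_ge0 c) F) (representable x))).
  by apply: ereal_inf_lbound; exists x.
rewrite rho_inf_weight; apply/rho_le => [j||j].
- exact: weight_ge0.
- by rewrite adde_ge0 ?rho_ge0.
apply: le_trans (weightP (rho_to (representable x)) j k) _.
rewrite addeA addeC; apply: leeD => //.
exact: le_add_rho c (representable k) j.
Qed.

Lemma inf_weight_bounded_ideal (c : weight K) :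
  bounded_ideals c -> (forall k, bounded_ideals (F k)) ->
  bounded_ideals (inf_weight (weight_ge0 c) F : PX X).
Proof.
move=> [cb cI] FJ; split.
  by apply: inf_weight_bounded => // k; case: (FJ k).
by apply: inf_weight_ideal => // k; case: (FJ k).
Qed.

End Colimit.

Lemma representable_bounded_ideal (R : realType) (X : qmet R) (x : X) :
  bounded_ideals (representable x : PX X).
Proof.
split.
  apply: (@le_lt_trans _ _ 0); last exact: ltry.
  by apply: ereal_inf_lbound; exists x => //; exact: rhoxx.
split; last by move=> lam mu; rewrite !rho_representable.
apply/eqP; rewrite eq_le; apply/andP; split.
  by apply: ereal_inf_lbound; exists x => //; exact: qdxx.
by apply: le_ereal_inf_tmp => _ [y _ <-]; exact: weight_ge0.
Qed.

(** * Functoriality of the pushforward *)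

Lemma nonexp_inj (R : realType) (X Y : qmet R) (f g : nonexp X Y) :
  f =1 g -> f = g.
Proof.
case: f g => [f fP] [g gP] /= /funext fg; subst g.
by congr NonExp; exact: Prop_irrelevance.
Qed.

Lemma subspace_inj (R : realType) (X : qmet R) (S : set X)
    (u v : Defs.subspace S) : sval u = sval v -> u = v.
Proof. exact: (eq_sig_hprop (fun x => @Prop_irrelevance (S x)) u v). Qed.

Section Pushforward.
Variables (R : realType) (X Y : qmet R) (f : nonexp X Y).

Lemma representable_comp_nonexp x y :
  qd (representable (f x) : PX Y) (representable (f y)) <= qd x y.
Proof.
by rewrite [leLHS](rho_representable _ (representable (f y))); exact: nonexpP.
Qed.

Lemma pushforward_bounded_ideal (phi : weight X) :
  bounded_ideals (phi : PX X) -> bounded_ideals (pushforward f phi : PX Y).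
Proof.
move=> phiJ.
apply: (inf_weight_bounded_ideal (F := NonExp representable_comp_nonexp)) => //.
by move=> k; exact: representable_bounded_ideal.
Qed.

Lemma rho_pushforward (phi : weight X) (psi : weight Y) :
  rho (pushforward f phi) psi = rho phi (psi \o f).
Proof.
by rewrite rho_inf_weight; apply: eq_rho => x; rewrite rho_representable.
Qed.

Program Definition weight_comp (psi : weight Y) : weight X :=
  @Weight R X (psi \o f) _ _.
Next Obligation. by move=> psi x; exact: weight_ge0. Qed.
Next Obligation.
move=> psi x y /=; apply: le_trans (weightP psi (f x) (f y)) _.
by apply: leeD => //; exact: nonexpP.
Qed.

(** By the formula for distances out of a pushforward, it is enough that
    [f^-> psi \o f <= psi]. *)
Lemma pushforward_nonexp (phi psi : weight X) :
  rho (pushforward f phi) (pushforward f psi) <= rho phi psi.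
Proof.
rewrite rho_pushforward; apply/rho_le => [x||x].
- exact: weight_ge0.
- exact: rho_ge0.
apply: le_trans (le_add_rho phi psi x).
(* [x] itself is an index of the infimum, with [d(f x, f x) = 0] *)
by apply: ereal_inf_lbound; exists x => //=; rewrite qdxx adde0.
Qed.

Local Notation J Z := (Defs.subspace (@bounded_ideals R Z)).

Definition pushforward_sub (u : J X) : J Y :=
  exist _ (pushforward f (sval u) : PX Y)
    (pushforward_bounded_ideal (proj2_sig u)).

Definition pushforward_map : nonexp (J X) (J Y) :=
  @NonExp R (J X) (J Y) pushforward_sub
    (fun u v => pushforward_nonexp (sval u) (sval v)).

End Pushforward.

Lemma pushforward_id (R : realType) (X : qmet R) (phi : weight X) :
  pushforward (nonexp_id X) phi = phi.
Proof. by apply: weight_eq_rho => psi; rewrite rho_pushforward. Qed.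

Lemma pushforward_comp (R : realType) (X Y Z : qmet R) (g : nonexp Y Z)
    (f : nonexp X Y) (phi : weight X) :
  pushforward (nonexp_comp g f) phi = pushforward g (pushforward f phi).
Proof.
apply: weight_eq_rho => psi.
by rewrite !rho_pushforward (rho_pushforward f phi (weight_comp g psi)).
Qed.

Theorem proposition4p4 (R : realType) :
  class_of_weights (@bounded_ideals R) /\ saturated (@bounded_ideals R).
Proof.
split.
  split; last by move=> X x; exact: representable_bounded_ideal.
  unshelve eexists.
    exists (@pushforward_map R) => [X|X Y Z g f].
      by apply: nonexp_inj => u; apply: subspace_inj; exact: pushforward_id.
    by apply: nonexp_inj => u; apply: subspace_inj; exact: pushforward_comp.
  by [].
move=> X Phi PhiJ; split.
  by move=> psi; exact: rho_inf_weight.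
apply: (inf_weight_bounded_ideal (F := inclusion (@bounded_ideals R X))) => //.
by move=> u; exact: (proj2_sig u).
Qed.
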